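(* Let $\mathbf{A}_1 \in \mathbb{C}^{m \times p_1}$, $\mathbf{A}_2 \in \mathbb{C}^{m \times p_2}$, and let $\boldsymbol{\Psi}_1 \in \mathbb{C}^{n_1 \times p_1}$ and $\boldsymbol{\Psi}_2 \in \mathbb{C}^{n_2 \times p_2}$, with $n_\ell \ge p_\ell$ for $\ell = 1,2$, be full-rank matrices (i.e. of full column rank). Assume that all columns of $\mathbf{A}_1\boldsymbol{\Psi}_1^\dagger$ and $\mathbf{A}_2\boldsymbol{\Psi}_2^\dagger$ are nonzero. Set $$\hat\mu_1 = \hat\mu(\mathbf{A}_1\boldsymbol{\Psi}_1^\dagger),\quad \hat\mu_2 = \hat\mu(\mathbf{A}_2\boldsymbol{\Psi}_2^\dagger),\quad \hat\mu_m = \hat\mu_m(\mathbf{A}_1\boldsymbol{\Psi}_1^\dagger, \mathbf{A}_2\boldsymbol{\Psi}_2^\dagger),\quad \hat\mu_{\max} = \max\{\hat\mu_1,\hat\mu_2,\hat\mu_m\},$$ and assume (without loss of generality) that $\hat\mu_1 \le \hat\mu_2$. Let $k_1$ and $k_2$ be nonnegative integers such that $$k_1 + k_2 < \max\left\{\frac{2(1+\hat\mu_2)}{\hat\mu_2 + 2\hat\mu_{\max} + \sqrt{\hat\mu_2^2 + \hat\mu_m^2}},\ \frac{1+\hat\mu_{\max}}{2\hat\mu_{\max}}\right\}.$$ Then there exist constants $C_0, C_1 \ge 0$, depending only on $\mathbf{A}_1,\mathbf{A}_2,\boldsymbol{\Psi}_1,\boldsymbol{\Psi}_2,k_1,k_2$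 (in particular not on $\mathbf{x}_1,\mathbf{x}_2$), such that the following holds. For all $\varepsilon \ge 0$, all $\mathbf{x}_1 \in \mathbb{C}^{p_1}$, $\mathbf{x}_2 \in \mathbb{C}^{p_2}$, and all $\mathbf{e} \in \mathbb{C}^m$ with $\|\mathbf{e}\|_2 \le \varepsilon$, if $\mathbf{y} = \mathbf{A}_1\mathbf{x}_1 + \mathbf{A}_2\mathbf{x}_2 + \mathbf{e}$ and $(\mathbf{x}_1^*, \mathbf{x}_2^* )$ is a solution of the convex program $$\underset{\widetilde{\mathbf{x}}_1 \in \mathbb{C}^{p_1},\, \widetilde{\mathbf{x}}_2 \in \mathbb{C}^{p_2}}{\text{minimize}}\ \|\boldsymbol{\Psi}_1\widetilde{\mathbf{x}}_1\|_1 + \|\boldsymbol{\Psi}_2\widetilde{\mathbf{x}}_2\|_1 \quad \text{subject to}\quad \|\mathbf{y} - \mathbf{A}_1\widetilde{\mathbf{x}}_1 - \mathbf{A}_2\widetilde{\mathbf{x}}_2\|_2 \le \varepsilon,$$ then, with $\mathbf{x} = [\mathbf{x}_1^T\ \mathbf{x}_2^T]^T$ and $\mathbf{x}^* = [{\mathbf{x}_1^*}^T\ {\mathbf{x}_2^*}^T]^T$, $$\|\mathbf{x}^* - \mathbf{x}\|_2 \le C_0\,\varepsilon + C_1\left(\sigma_{k_1}(\boldsymbol{\Psi}_1\mathbf{x}_1) + \sigma_{k_2}(\boldsymbol{\Psi}_2\mathbf{x}_2)\right).$$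
   Context: Notation. $\mathbf{M}^H$ is the conjugate transpose, $\mathbf{M}^\dagger$ the Moore–Penrose inverse, $[\mathbf{M}]_j$ the $j$th column and $[\mathbf{M}]_{i,j}$ the $(i,j)$ entry of a matrix $\mathbf{M}$. For a complex vector $\mathbf{u}$, $\|\mathbf{u}\|_1 = \sum_k |[\mathbf{u}]_k|$ and $\|\mathbf{u}\|_2$ is the Euclidean norm. Put $\omega_{\min}(\mathbf{M}) = \min_j \|[\mathbf{M}]_j\|_2$ and $\omega_{\min}(\mathbf{M},\mathbf{N}) = \min\{\omega_{\min}(\mathbf{M}), \omega_{\min}(\mathbf{N})\}$. Coherence. For a matrix $\mathbf{M}$ with nonzero (not necessarily normalized) columns, its coherence is $$\hat\mu(\mathbf{M}) = \max_{i \ne j} \frac{|[\mathbf{M}^H\mathbf{M}]_{i,j}|}{\omega_{\min}^2(\mathbf{M})}.$$ Mutual coherence. For matrices $\mathbf{M}, \mathbf{N}$ with the same number of rows and with nonzero columns, $$\hat\mu_m(\mathbf{M},\mathbf{N}) = \max_{i,j} \frac{|[\mathbf{M}^H\mathbf{N}]_{i,j}|}{\omega_{\min}^2(\mathbf{M},\mathbf{N})}.$$ Best $k$-term approximation error. For a vector $\mathbf{u}$, $\sigma_k(\mathbf{u}) = \|\mathbf{u} - \mathbf{u}_{\mathcal{S}}\|_1$, where $\mathcal{S}$ is the set of indices of the $k$ largest (in magnitude) entries of $\mathbf{u}$ and $\mathbf{u}_{\mathcal{S}}$ agrees with $\mathbf{u}$ on $\mathcal{S}$ and vanishes elsewhere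 ($\sigma_k(\mathbf{u}) = 0$ if $k$ is at least the length of $\mathbf{u}$). Conventions: a maximum over an empty index set is $0$; a fraction with positive numerator and zero denominator is $+\infty$. *)

(* Defs.v *)
From HB Require Import structures.
From mathcomp Require Import all_boot all_order all_algebra.
From mathcomp Require Import complex.
From mathcomp Require Import boolp classical_sets reals constructive_ereal.

Set Implicit Arguments.
Unset Strict Implicit.
Unset Printing Implicit Defensive.

Import Order.TTheory GRing.Theory Num.Theory.

Local Open Scope ring_scope.
Local Open Scope sesquilinear_scope.

(* [R[i]] is the field of complex numbers over the reals [R]; [normc] is the  *)
(* modulus as an element of [R] (the generic norm [`|z|] has values in R[i]). *)
Notation normc := ComplexField.Normc.normc.

Section Definitions.
Variable R : realType.
Local Notation C := R[i].

Definition norm1 n (u : 'cV[C]_n) : R := \sum_(i < n) normc (u i 0).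

Definition norm2 n (u : 'cV[C]_n) : R :=
  Num.sqrt (\sum_(i < n) normc (u i 0) ^+ 2).

Definition moore_penrose m n (M : 'M[C]_(m, n)) (X : 'M[C]_(n, m)) : Prop :=
  [/\ M *m X *m M = M,
      X *m M *m X = X,
      (M *m X)^t* = M *m X &
      (X *m M)^t* = X *m M].

(* The default value 0 is never used, see [mpinvP].                           *)
Definition mpinv m n (M : 'M[C]_(m, n)) : 'M[C]_(n, m) :=
  xget 0 [set X | moore_penrose M X]%classic.

(* The minimum is taken in the extended reals so that [+oo] is neutral; for a *)
(* matrix without columns the value is the junk value [fine +oo = 0], which   *)
(* the (then empty) maxima below never use.                                   *)
Definition omega_min m n (M : 'M[C]_(m, n)) : R :=
  fine (\big[Order.min/+oo%E]_(j < n) (norm2 (col j M))%:E).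

(* In the next two definitions all terms are nonnegative, so starting the     *)
(* maximum from 0 only affects empty index sets.                              *)
Definition coherence m n (M : 'M[C]_(m, n)) : R :=
  \big[Num.max/0]_(i < n) \big[Num.max/0]_(j < n | i != j)
    (normc ((M^t* *m M) i j) / omega_min M ^+ 2).

Definition mutual_coherence m n1 n2 (M : 'M[C]_(m, n1)) (N : 'M[C]_(m, n2)) :
    R :=
  \big[Num.max/0]_(i < n1) \big[Num.max/0]_(j < n2)
    (normc ((M^t* *m N) i j) / Num.min (omega_min M) (omega_min N) ^+ 2).

(* Indices of the k largest entries in modulus (all of them when n <= k). The *)
(* sort is stable: among entries of equal modulus, smaller indices win.       *)
Definition largest k n (u : 'cV[C]_n) : {set 'I_n} :=
  [set i in take k
     (sort (fun i j => normc (u j 0) <= normc (u i 0)) (enum 'I_n))].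

Definition keep n (S : {set 'I_n}) (u : 'cV[C]_n) : 'cV[C]_n :=
  \col_i (if i \in S then u i 0 else 0).

Definition best_approx_err k n (u : 'cV[C]_n) : R :=
  norm1 (u - keep (largest k u) u).

Section Recovery.
Variables (m p1 p2 n1 n2 : nat).
Variables (A1 : 'M[C]_(m, p1)) (A2 : 'M[C]_(m, p2)).
Variables (Psi1 : 'M[C]_(n1, p1)) (Psi2 : 'M[C]_(n2, p2)).

Definition feasible (eps : R) (y : 'cV[C]_m) (x1 : 'cV[C]_p1) (x2 : 'cV[C]_p2)
    : Prop :=
  norm2 (y - A1 *m x1 - A2 *m x2) <= eps.

Definition is_solution (eps : R) (y : 'cV[C]_m)
    (x1 : 'cV[C]_p1) (x2 : 'cV[C]_p2) : Prop :=
  feasible eps y x1 x2 /\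
  forall (z1 : 'cV[C]_p1) (z2 : 'cV[C]_p2), feasible eps y z1 z2 ->
    norm1 (Psi1 *m x1) + norm1 (Psi2 *m x2) <=
    norm1 (Psi1 *m z1) + norm1 (Psi2 *m z2).

End Recovery.

End Definitions.

Section Facts.
Variable R : realType.
Local Notation C := R[i].

Lemma trmxC_mul m n p (A : 'M[C]_(m, n)) (B : 'M[C]_(n, p)) :
  (A *m B)^t* = B^t* *m A^t*.
Proof. by rewrite trmx_mul map_mxM. Qed.

Lemma gram_eq0 m n (A : 'M[C]_(m, n)) : A^t* *m A = 0 -> A = 0.
Proof.
move=> A0; apply/matrixP => i j; rewrite mxE.
have /matrixP/(_ j j) := A0; rewrite !mxE => /eqP.
rewrite psumr_eq0 => [/allP/(_ i (mem_index_enum _))|k _].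
  by rewrite !mxE mulrC -normCK expf_eq0 /= normr_eq0 => /eqP.
by rewrite !mxE mulrC -normCK exprn_ge0.
Qed.

Lemma gram_unit m n (A : 'M[C]_(m, n)) :
  \rank A = n -> A^t* *m A \in unitmx.
Proof.
move=> rA; rewrite -row_free_unit; apply/row_freeP; apply/row_freeP.
rewrite -kermx_eq0; apply/eqP.
set K := kermx _; have K0 : K *m (A^t* *m A) = 0 by exact: mulmx_ker.
have AK0 : A *m K^t* = 0.
  by apply: gram_eq0; rewrite trmxC_mul trmxCK mulmxA -(mulmxA K) K0 mul0mx.
have KA0 : K *m A^t* = 0.
  by rewrite -[K]trmxCK -trmxC_mul AK0 trmx0 map_mx0.
apply/eqP; rewrite -(mulmx_free_eq0 _ (B := A^t*)) ?KA0 //.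
by rewrite /row_free mxrank_map mxrank_tr rA.
Qed.

Lemma moore_penrose_uniq m n (M : 'M[C]_(m, n)) X Y :
  moore_penrose M X -> moore_penrose M Y -> X = Y.
Proof.
move=> [X1 X2 X3 X4] [Y1 Y2 Y3 Y4].
have MXY : M *m X = M *m Y.
  by rewrite -X3 -{1}Y1 -[M *m Y *m M *m X]mulmxA trmxC_mul X3 Y3 !mulmxA X1.
have XYM : X *m M = Y *m M.
  rewrite -X4 -{1}Y1 -[M *m Y *m M]mulmxA mulmxA trmxC_mul X4 Y4.
  by rewrite -!mulmxA (mulmxA M) X1.
by rewrite -X2 XYM -mulmxA MXY mulmxA Y2.
Qed.

Lemma moore_penrose_ex m n (M : 'M[C]_(m, n)) : exists X, moore_penrose M X.
Proof.
suff fullrank r (L : 'M[C]_(m, r)) (Q : 'M[C]_(r, n)) :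
    \rank L = r -> \rank Q = r -> exists X, moore_penrose (L *m Q) X.
  rewrite -(mulmx_base M); apply: fullrank; apply/eqP.
    exact: col_base_full.
  exact: row_base_free.
move=> rL rQ.
have GL : L^t* *m L \in unitmx by exact: gram_unit.
have GQ : Q *m Q^t* \in unitmx.
  rewrite -{1}[Q]trmxCK; apply: gram_unit.
  by rewrite mxrank_map mxrank_tr.
pose X := Q^t* *m invmx (Q *m Q^t*) *m (invmx (L^t* *m L) *m L^t*).
have QX : Q *m X = invmx (L^t* *m L) *m L^t*.
  by rewrite /X !mulmxA mulmxV // mul1mx.
have XL : X *m L = Q^t* *m invmx (Q *m Q^t*).
  by rewrite /X -!mulmxA mulVmx // mulmx1.
have MX : L *m Q *m X = L *m invmx (L^t* *m L) *m L^t*.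
  by rewrite -mulmxA QX mulmxA.
have XM : X *m (L *m Q) = Q^t* *m invmx (Q *m Q^t*) *m Q.
  by rewrite mulmxA XL.
exists X; split.
- by rewrite -mulmxA XM !mulmxA -(mulmxA L) mulmxK.
- by rewrite XM -(mulmxA _ Q) QX.
- by rewrite MX !trmxC_mul trmxCK trmx_inv map_invmx trmxC_mul trmxCK mulmxA.
- by rewrite XM !trmxC_mul trmxCK trmx_inv map_invmx trmxC_mul trmxCK mulmxA.
Qed.

Lemma mpinvP m n (M : 'M[C]_(m, n)) : moore_penrose M (mpinv M).
Proof.
rewrite /mpinv; case: xgetP => [X _ //|noX].
by have [X /noX] := moore_penrose_ex M.
Qed.

End Facts.

(* Main.v *)
(* Let h_l = Psi_l (x_l^* - x_l), so that D1 h1 + D2 h2 has entries bounded by *)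
(* 2 eps. Reading the Gram matrix of [D1 D2] row by row gives, for a bounding *)
(* the coherences and d >= a the mutual coherence, the pointwise bound        *)
(*   (1 + a) |h_l i| <= r + a ||h_l||_1 + d ||h_l'||_1  (r = O(eps), l' <> l).*)
(* Multiply by |h_l i|, sum over the K = k1 + k2 largest entries of Psi x,    *)
(* and bound the sum of squares below by s^2 / K, where s is the l1-mass of h *)
(* on these entries. Since the mass off them is at most s + 2 E by optimality *)
(* (E is the sum of the two sigma's), and 2 s1 s2 <= s^2 / 2, this yields     *)
(*   (1 + a - K (a + 3 d) / 2) s <= K (r + 2 d E).                            *)
(* Both thresholds of the theorem make the left factor positive: the first    *)
(* with a = mu2, d = mumax, as sqrt (mu2^2 + mum^2) >= mumax, and the second  *)
(* with a = d = mumax.                                                        *)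
Require Import Defs.
From HB Require Import structures.
From mathcomp Require Import all_boot all_order all_algebra.
From mathcomp Require Import complex ring lra.
From mathcomp Require Import boolp classical_sets reals constructive_ereal.
Import Order.TTheory GRing.Theory Num.Theory.
Local Open Scope ring_scope.
Set Implicit Arguments.
Unset Strict Implicit.
Unset Printing Implicit Defensive.

(** The estimate is made for [Psi x] instead of [x]. As [mpinv Psi] is a left inverse of [Psi], one
    has [A x = D (Psi x)], and an error [h] in [Psi x] carries back to [x] at the cost of a constant
    factor. Low coherence makes the Gram matrix of the concatenated dictionary diagonally dominant,
    so a small [D1 h1 + D2 h2] forces [h] to be spread out: no entry exceeds the noise level plus a
    small multiple of the l1-mass ([coef_le]). Optimality pulls the other way: up to the
    approximation error, at least half of that mass sits on [k1 + k2] entries ([cone_le]).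
    [two_block_recovery] turns this conflict into a bound on the mass, [l1_error_le] states it for
    matrices, and [threshold_params] picks the [a] for which the bound has content. *)

(** * Concentration against spread, for nonnegative real weights *)

Section RealBounds.
Variable R : realType.

Lemma sum_sqr_le_sqr_sum (n : nat) (w : 'I_n -> R) :
  (forall i, 0 <= w i) -> \sum_i w i ^+ 2 <= (\sum_i w i) ^+ 2.
Proof.
move=> w0; rewrite [leRHS]expr2 mulr_suml; apply: ler_sum => i _.
rewrite expr2; apply: ler_wpM2l => //.
by rewrite (bigD1 i) //= lerDl sumr_ge0.
Qed.

(* [w^2 >= 2 l w - l^2] replaces Cauchy-Schwarz; the optimal [l] is the mean *)
(* [(\sum_S w) / k], but both blocks must share one [l].                      *)
Lemma sum_peak_le (n k : nat) (S : {set 'I_n}) (w : 'I_n -> R) (c X l : R) :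
  0 <= c -> (#|S| <= k)%N -> (forall i, 0 <= w i) ->
  (forall i, c * w i <= X) ->
  c * (2 * l * \sum_(i in S) w i - k%:R * l ^+ 2) <= (\sum_(i in S) w i) * X.
Proof.
move=> c0 Sk w0 wX.
apply: (@le_trans _ _ (c * \sum_(i in S) w i ^+ 2)).
  apply: ler_wpM2l => //.
  apply: (@le_trans _ _ (\sum_(i in S) (2 * l * w i - l ^+ 2))).
    rewrite sumrB -mulr_sumr lerB // sumr_const -[_ *+ #|_|]mulr_natl.
    by apply: ler_wpM2r; rewrite ?sqr_ge0 // ler_nat.
  apply: ler_sum => i _; have := sqr_ge0 (w i - l); nra.
rewrite mulr_sumr mulr_suml; apply: ler_sum => i _.
by have := ler_wpM2l (w0 i) (wX i); rewrite expr2; nra.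
Qed.

Lemma two_block_recovery (n1 n2 k1 k2 : nat) (S1 : {set 'I_n1})
    (S2 : {set 'I_n2}) (w1 : 'I_n1 -> R) (w2 : 'I_n2 -> R) (a d r e : R) :
  let s := \sum_(i in S1) w1 i + \sum_(i in S2) w2 i in
  let t := \sum_(i in ~: S1) w1 i + \sum_(i in ~: S2) w2 i in
  let K := (k1 + k2)%N%:R in
  0 <= a -> a <= d -> (#|S1| <= k1)%N -> (#|S2| <= k2)%N ->
  (forall i, 0 <= w1 i) -> (forall i, 0 <= w2 i) ->
  (forall i, (1 + a) * w1 i <= r + a * (\sum_j w1 j) + d * (\sum_j w2 j)) ->
  (forall i, (1 + a) * w2 i <= r + a * (\sum_j w2 j) + d * (\sum_j w1 j)) ->
  t <= s + 2 * e -> 0 <= r -> 0 <= e ->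
  (1 + a - K * (a + 3 * d) / 2) * s <= K * (r + 2 * d * e).
Proof.
move=> s t K a0 ad S1k S2k w10 w20 b1 b2 ts r0 e0.
have K0 : 0 <= K by exact: ler0n.
have split n (S : {set 'I_n}) (w : 'I_n -> R) :
    \sum_j w j = \sum_(i in S) w i + \sum_(i in ~: S) w i.
  by rewrite (bigID (mem S)) /=; congr (_ + _); apply: eq_bigl => i; rewrite inE.
have c0 : 0 <= 1 + a by lra.
have q1 l := sum_peak_le l c0 S1k w10 b1.
have q2 l := sum_peak_le l c0 S2k w20 b2.
rewrite (split _ S1 w1) (split _ S2 w2) in q1 q2.
have s10 : 0 <= \sum_(i in S1) w1 i by exact: sumr_ge0.
have s20 : 0 <= \sum_(i in S2) w2 i by exact: sumr_ge0.
have t10 : 0 <= \sum_(i in ~: S1) w1 i by exact: sumr_ge0.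
have t20 : 0 <= \sum_(i in ~: S2) w2 i by exact: sumr_ge0.
(* The choice [l = s / K] below needs [K] nonzero; for [K = 0] both sets are empty and [s = 0]. *)
have [K00|K_neq0] := eqVneq (k1 + k2)%N 0%N.
  move: K00 S1k S2k => /eqP; rewrite addn_eq0 => /andP[/eqP-> /eqP->].
  rewrite !leqn0 !cards_eq0 => /eqP S10 /eqP S20.
  have -> : s = 0 by rewrite /s S10 S20 !big_set0 addr0.
  by rewrite mulr0; apply: mulr_ge0 => //; nra.
have Kgt0 : 0 < K by rewrite ltr0n lt0n.
(* With this shared [l], the two lower bounds add up to [(1 + a) (2 l s - K l^2) = (1 + a) l s]. *)
move: (q1 (s / K)) (q2 (s / K)); clear q1 q2 split b1 b2.
have KE : K = k1%:R + k2%:R by rewrite /K natrD.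
move: ts s10 s20 t10 t20; rewrite /t.
have : s = K * (s / K) by field; lra.
move: (s / K) => l; rewrite /s.
move: (\sum_(i in S1) w1 i) (\sum_(i in ~: S1) w1 i) => s1 t1.
move: (\sum_(i in S2) w2 i) (\sum_(i in ~: S2) w2 i) => s2 t2.
move: k1%:R k2%:R KE => x1 x2; move: K Kgt0 K0 => {s t S1k S2k K_neq0}.
move=> K Kgt0 K0 KE sl ts s10 s20 t10 t20 q1 q2.
have [s0|s0] := eqVneq (s1 + s2) 0; first by rewrite s0 mulr0 mulr_ge0 //; nra.
have sgt0 : 0 < s1 + s2 by rewrite lt_neqAle eq_sym s0 addr_ge0.
have key : (1 + a) * l * (s1 + s2) <=
    (s1 + s2) * (r + (a + 3 * d) / 2 * (s1 + s2) + 2 * d * e).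
  have -> : (1 + a) * l * (s1 + s2) =
     (1 + a) * (2 * l * s1 - x1 * l ^+ 2) + (1 + a) * (2 * l * s2 - x2 * l ^+ 2).
    have -> : x1 = K - x2 by lra.
    have -> : (1 + a) * (2 * l * s1 - (K - x2) * l ^+ 2) +
        (1 + a) * (2 * l * s2 - x2 * l ^+ 2) =
        (1 + a) * (2 * (l * (s1 + s2)) - K * l ^+ 2) by ring.
    by rewrite -mulrA sl; ring.
  apply: (le_trans (lerD q1 q2)).
  (* On the peaks, [a (s1^2 + s2^2) + 2 d s1 s2 <= (a + d) / 2 * s^2], which is [H4]. Off them, [H3]
     replaces [a] by [d], and [H5] bounds [d s t] by [d s (s + 2 e)]. Together they give the
     coefficient [(a + 3 d) / 2]. *)
  have H1 : (s1 + s2) * (t1 + t2) <= (s1 + s2) * (s1 + s2 + 2 * e).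
    by apply: ler_wpM2l; lra.
  have H3 : 0 <= (d - a) * (s1 * t1 + s2 * t2) by apply: mulr_ge0; nra.
  have H4 : 0 <= (d - a) * (s1 - s2) ^+ 2 by apply: mulr_ge0; rewrite ?sqr_ge0; lra.
  have H5 : 0 <= d * ((s1 + s2) * (s1 + s2 + 2 * e) - (s1 + s2) * (t1 + t2)).
    by apply: mulr_ge0; lra.
  lra.
rewrite [leLHS]mulrC in key.
rewrite ler_pM2l // in key.
have := ler_wpM2l K0 key.
have -> : K * ((1 + a) * l) = (1 + a) * (s1 + s2) by rewrite sl; ring.
lra.
Qed.

End RealBounds.

(** * Complex norms, Gram matrices and coherence *)

Section ComplexBounds.
Variable R : realType.
Local Notation C := R[i].
Local Open Scope sesquilinear_scope.

Lemma normcE_norm (z : C) : (normc z)%:C%C = `|z|.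
Proof. by []. Qed.

Lemma normc_ge0 (z : C) : 0 <= normc z.
Proof. by case: z => x y; exact: sqrtr_ge0. Qed.

Lemma normc_conj (z : C) : normc z^* = normc z.
Proof. by apply/(@complexI R); rewrite !normcE_norm norm_conjC. Qed.

Lemma normcD_le (x y : C) : normc (x + y) <= normc x + normc y.
Proof. exact: (@le_normcD R). Qed.

Lemma normcN (x : C) : normc (- x) = normc x.
Proof. exact: (@complex.normcN R). Qed.

Lemma normc_sum (I : Type) (s : seq I) (P : pred I) (F : I -> C) :
  normc (\sum_(i <- s | P i) F i) <= \sum_(i <- s | P i) normc (F i).
Proof.
elim/big_ind2: _ => [|x1 x2 y1 y2 h1 h2|//].
  by rewrite ComplexField.Normc.normc0.
exact: le_trans (normcD_le _ _) (lerD h1 h2).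
Qed.

Lemma norm1_ge0 n (u : 'cV[C]_n) : 0 <= norm1 u.
Proof. by apply: sumr_ge0 => i _; exact: normc_ge0. Qed.

Lemma norm2_ge0 n (u : 'cV[C]_n) : 0 <= norm2 u.
Proof. exact: sqrtr_ge0. Qed.

Lemma norm2_sqr n (u : 'cV[C]_n) : norm2 u ^+ 2 = \sum_i normc (u i 0) ^+ 2.
Proof. by rewrite sqr_sqrtr // sumr_ge0 // => i _; rewrite sqr_ge0. Qed.

Lemma norm2_le_norm1 n (u : 'cV[C]_n) : norm2 u <= norm1 u.
Proof.
rewrite -(@ler_pXn2r _ 2) ?nnegrE ?norm1_ge0 ?norm2_ge0 //.
by rewrite norm2_sqr sum_sqr_le_sqr_sum // => i; exact: normc_ge0.
Qed.

Lemma normc_le_norm2 n (u : 'cV[C]_n) i : normc (u i 0) <= norm2 u.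
Proof.
rewrite -(@ler_pXn2r _ 2) ?nnegrE ?normc_ge0 ?norm2_ge0 //.
by rewrite norm2_sqr (bigD1 i) //= lerDl sumr_ge0 // => j _; rewrite sqr_ge0.
Qed.

Lemma norm2_gt0 n (u : 'cV[C]_n) : u != 0 -> 0 < norm2 u.
Proof.
move=> u0; rewrite lt_neqAle norm2_ge0 andbT; apply: contra u0 => /eqP u0.
apply/eqP/matrixP => i j; rewrite ord1 mxE; apply: ComplexField.Normc.eq0_normc.
by apply/le_anti; rewrite normc_ge0 u0 normc_le_norm2.
Qed.

Lemma norm1_col_mx n1 n2 (u : 'cV[C]_n1) (v : 'cV[C]_n2) :
  norm1 (col_mx u v) = norm1 u + norm1 v.
Proof.
rewrite /norm1 big_split_ord /=.
by congr (_ + _); apply: eq_bigr => i _; rewrite ?col_mxEu ?col_mxEd.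
Qed.

Lemma norm1_mulmx_le m n (M : 'M[C]_(m, n)) (u : 'cV[C]_n) :
  norm1 (M *m u) <= (\sum_i \sum_j normc (M i j)) * norm1 u.
Proof.
rewrite mulr_suml; apply: ler_sum => i _; rewrite mxE.
apply: le_trans (normc_sum _ _ _) _.
rewrite mulr_suml; apply: ler_sum => j _; rewrite ComplexField.Normc.normcM.
apply: ler_wpM2l; first exact: normc_ge0.
by rewrite /norm1 (bigD1 j) //= lerDl sumr_ge0 // => k _; exact: normc_ge0.
Qed.

Lemma gram_diag m n (M : 'M[C]_(m, n)) i :
  normc ((M^t* *m M) i i) = norm2 (col i M) ^+ 2.
Proof.
apply/(@complexI R); rewrite normcE_norm mxE.
under eq_bigr => k _ do rewrite !mxE mulrC -normCK.
rewrite ger0_norm; last by apply: sumr_ge0 => k _; rewrite exprn_ge0.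
rewrite norm2_sqr rmorph_sum; apply: eq_bigr => k _.
by rewrite !mxE rmorphXn /= normcE_norm.
Qed.

Lemma normc_gram_sym m n1 n2 (M : 'M[C]_(m, n1)) (N : 'M[C]_(m, n2)) i j :
  normc ((N^t* *m M) i j) = normc ((M^t* *m N) j i).
Proof. by rewrite -{1}(trmxCK M) -trmxC_mul !mxE normc_conj. Qed.

(** The index [i] guarantees a column, so the extended minimum is finite and [fine] returns its true
    value. *)
Lemma omega_min_le m n (M : 'M[C]_(m, n)) i : omega_min M <= norm2 (col i M).
Proof.
have le := @bigmin_le _ _ _ +oo%E i (fun j => (norm2 (col j M))%:E).
have ge : (0 <= \big[Order.min/+oo]_(j < n) (norm2 (col j M))%:E)%E.
  apply/bigmin_geP; split=> [|j _]; first exact: leey.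
  by rewrite lee_fin norm2_ge0.
rewrite -lee_fin /omega_min fineK // ge0_fin_numE //.
exact: le_lt_trans le (ltry _).
Qed.

Lemma omega_min_gt0 m n (M : 'M[C]_(m, n)) (i : 'I_n) :
  (forall j, col j M != 0) -> 0 < omega_min M.
Proof.
move=> M0.
have le := @bigmin_le _ _ _ +oo%E i (fun j => (norm2 (col j M))%:E).
apply: fine_gt0; apply/andP; split; last exact: le_lt_trans le (ltry _).
apply/bigmin_gtP; split=> [|j _]; first exact: ltry.
by rewrite lte_fin norm2_gt0.
Qed.

Lemma coherence_ge0 m n (M : 'M[C]_(m, n)) : 0 <= coherence M.
Proof. exact: bigmax_ge_id. Qed.

Lemma mutual_coherence_ge0 m n1 n2 (M : 'M[C]_(m, n1)) (N : 'M[C]_(m, n2)) :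
  0 <= mutual_coherence M N.
Proof. exact: bigmax_ge_id. Qed.

(** Enlarging [omega_min] to the norm of column [i] lets row [i] of the Gram matrix be divided by
    its own diagonal entry in [coef_le]; the columns need not be normalized. *)
Lemma gram_le_coherence m n (M : 'M[C]_(m, n)) i j :
  (forall j, col j M != 0) -> i != j ->
  normc ((M^t* *m M) i j) <= coherence M * norm2 (col i M) ^+ 2.
Proof.
move=> M0 ij; have om0 := omega_min_gt0 i M0.
apply: (@le_trans _ _ (coherence M * omega_min M ^+ 2)); last first.
  apply: ler_wpM2l; first exact: coherence_ge0.
  by rewrite ler_pXn2r ?nnegrE ?norm2_ge0 ?omega_min_le // ltW.
rewrite -ler_pdivrMr ?exprn_gt0 //.
apply: (bigmax_sup i) => //; exact: (bigmax_sup j).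
Qed.

(** The minimum of the two column norms serves rows of either block, since a cross entry is compared
    with the diagonal of whichever block is being estimated. *)
Lemma gram_le_mutual_coherence m n1 n2 (M : 'M[C]_(m, n1))
    (N : 'M[C]_(m, n2)) i j :
  (forall j, col j M != 0) -> (forall j, col j N != 0) ->
  normc ((M^t* *m N) i j) <=
    mutual_coherence M N * Num.min (norm2 (col i M)) (norm2 (col j N)) ^+ 2.
Proof.
move=> M0 N0.
have om0 : 0 < Num.min (omega_min M) (omega_min N).
  by rewrite lt_min (omega_min_gt0 i) ?(omega_min_gt0 j).
apply: (@le_trans _ _ (mutual_coherence M N *
    Num.min (omega_min M) (omega_min N) ^+ 2)); last first.
  apply: ler_wpM2l; first exact: mutual_coherence_ge0.
  rewrite ler_pXn2r ?nnegrE ?le_min ?norm2_ge0 ?(ltW om0) //.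
    by rewrite !ge_min !omega_min_le orbT.
  by move: om0; rewrite lt_min => /andP[/ltW -> /ltW ->].
rewrite -ler_pdivrMr ?exprn_gt0 //.
apply: (bigmax_sup i) => //; exact: (bigmax_sup j).
Qed.

(** Bounds the effect of an entrywise residual after division by any diagonal Gram entry. A sum over
    the columns dominates each term, which is enough for a constant independent of the signal. *)
Definition col_ratio m n (M : 'M[C]_(m, n)) : R :=
  \sum_i norm1 (col i M) / norm2 (col i M) ^+ 2.

Lemma col_ratio_ge0 m n (M : 'M[C]_(m, n)) : 0 <= col_ratio M.
Proof.
by apply: sumr_ge0 => i _; rewrite mulr_ge0 ?norm1_ge0 // invr_ge0 sqr_ge0.
Qed.

(** Row [i] of [M^H (M h + N g)] is solved for its diagonal term. The other entries of [h] have mass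
    [norm1 h - |h i|], and moving [a |h i|] to the left produces the factor [1 + a]. *)
Lemma coef_le m n1 n2 (M : 'M[C]_(m, n1)) (N : 'M[C]_(m, n2))
    (h : 'cV[C]_n1) (g : 'cV[C]_n2) (a d b : R) i :
  col i M != 0 -> 0 <= b ->
  (forall j, i != j ->
    normc ((M^t* *m M) i j) <= a * norm2 (col i M) ^+ 2) ->
  (forall j, normc ((M^t* *m N) i j) <= d * norm2 (col i M) ^+ 2) ->
  (forall k, normc ((M *m h + N *m g) k 0) <= b) ->
  (1 + a) * normc (h i 0) <= col_ratio M * b + a * norm1 h + d * norm1 g.
Proof.
move=> Mi0 b0 Ma Nd vb.
have w0 : 0 < norm2 (col i M) ^+ 2 by rewrite exprn_gt0 // norm2_gt0.
pose v := M *m h + N *m g.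
have Ev : (M^t* *m M) i i * h i 0 = (M^t* *m v) i 0 -
    \sum_(j | j != i) (M^t* *m M) i j * h j 0 -
    \sum_j (M^t* *m N) i j * g j 0.
  rewrite /v mulmxDr !mulmxA [in RHS]mxE.
  rewrite [X in X + _ - _ - _]mxE [X in _ + X - _ - _]mxE (bigD1 i) //=.
  by ring.
have bv : normc ((M^t* *m v) i 0) <= norm1 (col i M) * b.
  rewrite mxE; apply: le_trans (normc_sum _ _ _) _.
  rewrite mulr_suml; apply: ler_sum => k _.
  rewrite ComplexField.Normc.normcM !mxE normc_conj.
  apply: ler_wpM2l; first exact: normc_ge0.
  by have := vb k; rewrite !mxE.
have bM : normc (\sum_(j | j != i) (M^t* *m M) i j * h j 0) <=
    a * norm2 (col i M) ^+ 2 * (norm1 h - normc (h i 0)).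
  apply: le_trans (normc_sum _ _ _) _.
  have -> : norm1 h - normc (h i 0) = \sum_(j | j != i) normc (h j 0).
    by rewrite /norm1 (bigD1 i) //= addrAC subrr add0r.
  rewrite mulr_sumr.
  apply: ler_sum => j ji; rewrite ComplexField.Normc.normcM.
  by apply: ler_wpM2r; rewrite ?normc_ge0 // Ma // eq_sym.
have bN : normc (\sum_j (M^t* *m N) i j * g j 0) <=
    d * norm2 (col i M) ^+ 2 * norm1 g.
  apply: le_trans (normc_sum _ _ _) _.
  rewrite mulr_sumr; apply: ler_sum => j _; rewrite ComplexField.Normc.normcM.
  by apply: ler_wpM2r; rewrite ?normc_ge0.
have main : norm2 (col i M) ^+ 2 * normc (h i 0) <= norm1 (col i M) * b +
    a * norm2 (col i M) ^+ 2 * (norm1 h - normc (h i 0)) +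
    d * norm2 (col i M) ^+ 2 * norm1 g.
  rewrite -gram_diag -ComplexField.Normc.normcM Ev.
  apply: le_trans (normcD_le _ _) (lerD _ _); last first.
    by rewrite normcN gram_diag.
  apply: le_trans (normcD_le _ _) (lerD _ _) => //.
  by rewrite normcN gram_diag.
have ratio : norm1 (col i M) <= col_ratio M * norm2 (col i M) ^+ 2.
  rewrite -ler_pdivrMr // /col_ratio (bigD1 i) //= lerDl.
  by apply: sumr_ge0 => j _; rewrite mulr_ge0 ?norm1_ge0 // invr_ge0 sqr_ge0.
rewrite -(ler_pM2l w0).
have := ler_wpM2r b0 ratio; lra.
Qed.

(** Holds entry by entry: [|u| <= |u + h| + |h|] on [S], and [|h| <= |u + h| + |u|] off [S], where
    adding [|u|] to both sides gives the factor 2. *)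
Lemma cone_le n (S : {set 'I_n}) (u h : 'cV[C]_n) :
  norm1 u + \sum_(i in ~: S) normc (h i 0) <=
  norm1 (u + h) + \sum_(i in S) normc (h i 0) + 2 * norm1 (u - keep S u).
Proof.
rewrite [\sum_(i in ~: S) _]big_mkcond [\sum_(i in S) _]big_mkcond /=.
rewrite /norm1 mulr_sumr -!big_split /=.
apply: ler_sum => i _; rewrite !mxE inE.
have h0 := normc_ge0 (h i 0); have u0 := normc_ge0 (u i 0).
case: (i \in S) => /=.
  rewrite subrr ComplexField.Normc.normc0 mulr0 !addr0.
  rewrite -[X in normc X <= _](addrK (h i 0)).
  by apply: le_trans (normcD_le _ _) _; rewrite normcN.
rewrite subr0 addr0.
have := normcD_le (u i 0 + h i 0) (- u i 0).
by rewrite addrAC subrr add0r normcN; lra.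
Qed.

Lemma card_largest k n (u : 'cV[C]_n) : (#|largest k u| <= k)%N.
Proof.
rewrite cardsE; apply: leq_trans (card_size _) _.
by rewrite size_take; case: ltnP.
Qed.

(** Full column rank gives some left inverse [B], which cancels the leading [Psi] in the Penrose
    equation [Psi X Psi = Psi]. *)
Lemma mpinv_mulVmx n p (Psi : 'M[C]_(n, p)) :
  \rank Psi = p -> mpinv Psi *m Psi = 1%:M.
Proof.
move=> rP; have [PXP _ _ _] := mpinvP Psi.
have /row_fullP[B BP] : row_full Psi by rewrite /row_full rP.
by rewrite -[LHS]mul1mx -{1}BP -[LHS]mulmxA (mulmxA Psi) PXP.
Qed.

End ComplexBounds.

(** * The l1 error bound for the pair of dictionaries *)

Section Recovery.
Local Open Scope sesquilinear_scope.

(** The common bound [a] on both coherences and the sum [c] of both ratios make the blocks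
    interchangeable, as [two_block_recovery] requires. *)
Lemma l1_error_le (R : realType) (m n1 n2 k1 k2 : nat)
    (D1 : 'M[R[i]]_(m, n1)) (D2 : 'M[R[i]]_(m, n2)) (u1 h1 : 'cV[R[i]]_n1)
    (u2 h2 : 'cV[R[i]]_n2) (a d b : R) :
  let K := (k1 + k2)%N%:R in
  let E := best_approx_err k1 u1 + best_approx_err k2 u2 in
  let c := col_ratio D1 + col_ratio D2 in
  let eta := 1 + a - K * (a + 3 * d) / 2 in
  (forall j, col j D1 != 0) -> (forall j, col j D2 != 0) ->
  coherence D1 <= a -> coherence D2 <= a -> mutual_coherence D1 D2 <= d ->
  a <= d -> 0 < eta -> 0 <= b ->
  (forall k, normc ((D1 *m h1 + D2 *m h2) k 0) <= b) ->
  norm1 (u1 + h1) + norm1 (u2 + h2) <= norm1 u1 + norm1 u2 ->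
  norm1 h1 + norm1 h2 <= 2 * (K * (c * b + 2 * d * E) / eta) + 2 * E.
Proof.
move=> K E c eta D10 D20 mu1a mu2a mumd ad eta0 b0 vb opt.
have a0 : 0 <= a := le_trans (coherence_ge0 D1) mu1a.
have d0 : 0 <= d := le_trans a0 ad.
have c10 := col_ratio_ge0 D1; have c20 := col_ratio_ge0 D2.
have E0 : 0 <= E by apply: addr_ge0; exact: norm1_ge0.
have mutual i j : normc ((D1^t* *m D2) i j) <=
    d * Num.min (norm2 (col i D1)) (norm2 (col j D2)) ^+ 2.
  apply: le_trans (gram_le_mutual_coherence i j D10 D20) _.
  by apply: ler_wpM2r; rewrite ?sqr_ge0.
have minsq (x y z : R) : 0 <= x -> 0 <= y -> z = x \/ z = y ->
    d * Num.min x y ^+ 2 <= d * z ^+ 2.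
  move=> x0 y0 zxy; apply: ler_wpM2l => //.
  rewrite ler_pXn2r ?nnegrE ?le_min ?x0 ?y0 //; last by case: zxy => ->.
  by rewrite ge_min; case: zxy => ->; rewrite lexx ?orbT.
have w1 i : (1 + a) * normc (h1 i 0) <= c * b + a * norm1 h1 + d * norm1 h2.
  apply: le_trans (@coef_le _ _ _ _ D1 D2 h1 h2 a d b i _ b0 _ _ vb) _ => //.
  - move=> j ij; apply: le_trans (gram_le_coherence D10 ij) _.
    by apply: ler_wpM2r; rewrite ?sqr_ge0.
  - move=> j; apply: le_trans (mutual i j) _.
    by apply: minsq; rewrite ?norm2_ge0 //; left.
  - by rewrite !lerD2r ler_wpM2r // lerDl.
have w2 i : (1 + a) * normc (h2 i 0) <= c * b + a * norm1 h2 + d * norm1 h1.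
  rewrite addrC in vb.
  apply: le_trans (@coef_le _ _ _ _ D2 D1 h2 h1 a d b i _ b0 _ _ vb) _ => //.
  - move=> j ij; apply: le_trans (gram_le_coherence D20 ij) _.
    by apply: ler_wpM2r; rewrite ?sqr_ge0.
  - move=> j; rewrite normc_gram_sym; apply: le_trans (mutual j i) _.
    by apply: minsq; rewrite ?norm2_ge0 //; right.
  - by rewrite !lerD2r ler_wpM2r // lerDr.
have cone1 := cone_le (largest k1 u1) u1 h1.
have cone2 := cone_le (largest k2 u2) u2 h2.
have split n (S : {set 'I_n}) (h : 'cV[R[i]]_n) : norm1 h =
    \sum_(i in S) normc (h i 0) + \sum_(i in ~: S) normc (h i 0).
  rewrite /norm1 (bigID (mem S)) /=; congr (_ + _).
  by apply: eq_bigl => i; rewrite inE.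
have := @two_block_recovery _ _ _ k1 k2 (largest k1 u1) (largest k2 u2)
  (fun i => normc (h1 i 0)) (fun i => normc (h2 i 0)) a d (c * b) E
  a0 ad (card_largest _ _) (card_largest _ _) (fun=> normc_ge0 _)
  (fun=> normc_ge0 _) w1 w2.
rewrite -/K -/eta (split _ (largest k1 u1) h1) (split _ (largest k2 u2) h2).
move=> /(_ _ _ E0) rec.
have cb0 : 0 <= c * b by rewrite mulr_ge0 // addr_ge0.
have ts : \sum_(i in ~: largest k1 u1) normc (h1 i 0) +
    \sum_(i in ~: largest k2 u2) normc (h2 i 0) <=
    \sum_(i in largest k1 u1) normc (h1 i 0) +
    \sum_(i in largest k2 u2) normc (h2 i 0) + 2 * E.
  by move: cone1 cone2 opt; rewrite /E /best_approx_err; lra.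
(* The total mass is [s + t <= 2 s + 2 E], and dividing by [eta] bounds [s]. *)
by have := rec ts cb0; rewrite -(ler_pdivlMl _ _ eta0) mulrC; lra.
Qed.

End Recovery.

(** * Thresholds and the final constants *)

Lemma threshold_params (R : realType) (K mu2 mum mumax : R) :
  0 <= mu2 -> 0 <= mum -> mu2 <= mumax -> mumax = Num.max mu2 mum ->
  (K%:E <
    Order.max
      ((2 * (1 + mu2))%R%:E /
       (mu2 + 2 * mumax + Num.sqrt (mu2 ^+ 2 + mum ^+ 2))%R%:E)
      ((1 + mumax)%R%:E / (2 * mumax)%R%:E))%E ->
  exists2 a : R, mu2 <= a <= mumax & 0 < 1 + a - K * (a + 3 * mumax) / 2.
Proof.
move=> mu20 mum0 le2 maxE.
(* Here the threshold is infinite, but with [a = mumax = 0] the factor equals 1 for every [K]. *)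
have [mx0|mx_neq0] := eqVneq mumax 0.
  move=> _; exists mu2; first by rewrite lexx.
  have -> : mu2 = 0 by apply/le_anti; rewrite mu20 -mx0 le2.
  by rewrite mx0; lra.
have mx_gt0 : 0 < mumax by rewrite lt_neqAle eq_sym mx_neq0 (le_trans mu20).
set q := Num.sqrt _; have q0 : 0 <= q by exact: sqrtr_ge0.
have qmax : mumax <= q.
  rewrite -[mumax]gtr0_norm // -sqrtr_sqr ler_wsqrtr // maxE.
  by case: (leP mu2 mum) => _; rewrite ?lerDl ?lerDr sqr_ge0.
have den1 : 0 < mu2 + 2 * mumax + q by lra.
have den2 : 0 < 2 * mumax by lra.
rewrite !inver !gt_eqF // -!EFinM lt_max !lte_fin.
rewrite !ltr_pdivlMr // => /orP[lt1|lt2].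
  exists mu2; first by rewrite lexx.
  have [K0|K0] := leP 0 K; last by nra.
  have : K * (mu2 + 3 * mumax) <= K * (mu2 + 2 * mumax + q).
    by apply: ler_wpM2l => //; lra.
  lra.
by exists mumax; [rewrite le2 lexx | lra].
Qed.

Unset Implicit Arguments.
Set Strict Implicit.

Theorem theorem1 (R : realType) (m p1 p2 n1 n2 : nat)
    (A1 : 'M[R[i]]_(m, p1)) (A2 : 'M[R[i]]_(m, p2))
    (Psi1 : 'M[R[i]]_(n1, p1)) (Psi2 : 'M[R[i]]_(n2, p2))
    (k1 k2 : nat) :
  (p1 <= n1)%N -> (p2 <= n2)%N ->
  \rank Psi1 = p1 -> \rank Psi2 = p2 ->
  let D1 := A1 *m mpinv Psi1 in
  let D2 := A2 *m mpinv Psi2 in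
  (forall j : 'I_n1, col j D1 != 0) ->
  (forall j : 'I_n2, col j D2 != 0) ->
  let mu1 := coherence D1 in
  let mu2 := coherence D2 in
  let mum := mutual_coherence D1 D2 in
  let mumax := Num.max (Num.max mu1 mu2) mum in
  mu1 <= mu2 ->
  (((k1 + k2)%N%:R : R)%:E <
    Order.max
      ((2 * (1 + mu2))%R%:E /
       (mu2 + 2 * mumax + Num.sqrt (mu2 ^+ 2 + mum ^+ 2))%R%:E)
      ((1 + mumax)%R%:E / (2 * mumax)%R%:E))%E ->
  exists C0 C1 : R, [/\ 0 <= C0, 0 <= C1 &
    forall eps : R, 0 <= eps ->
    forall (x1 : 'cV[R[i]]_p1) (x2 : 'cV[R[i]]_p2) (e : 'cV[R[i]]_m),
    norm2 e <= eps ->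
    let y := A1 *m x1 + A2 *m x2 + e in
    forall (xs1 : 'cV[R[i]]_p1) (xs2 : 'cV[R[i]]_p2),
    is_solution A1 A2 Psi1 Psi2 eps y xs1 xs2 ->
    norm2 (col_mx xs1 xs2 - col_mx x1 x2) <=
      C0 * eps +
      C1 * (best_approx_err k1 (Psi1 *m x1) + best_approx_err k2 (Psi2 *m x2))].
Proof.
move=> _ _ rP1 rP2 D1 D2 D10 D20 mu1 mu2 mum mumax mu12 thr.
have mumaxE : mumax = Num.max mu2 mum by rewrite /mumax (max_idPr mu12).
have mu2max : mu2 <= mumax by rewrite mumaxE le_max lexx.
have mummax : mum <= mumax by rewrite mumaxE le_max lexx orbT.
have [a /andP[mu2a amax] eta0] := threshold_params (coherence_ge0 D2)
  (mutual_coherence_ge0 D1 D2) mu2max mumaxE thr.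
set K : R := (k1 + k2)%N%:R in eta0; set eta := (X in 0 < X) in eta0.
have mumax0 : 0 <= mumax := le_trans (coherence_ge0 D2) mu2max.
pose c := col_ratio D1 + col_ratio D2.
pose B := \sum_i \sum_j normc (mpinv Psi1 i j) +
          \sum_i \sum_j normc (mpinv Psi2 i j).
have sum_ge0 q n (M : 'M[R[i]]_(q, n)) : 0 <= \sum_i \sum_j normc (M i j).
  by do 2![apply: sumr_ge0 => ? _]; exact: normc_ge0.
have B0 : 0 <= B by rewrite addr_ge0.
have c0 : 0 <= c by rewrite addr_ge0 ?col_ratio_ge0.
have Keta0 : 0 <= K / eta by rewrite divr_ge0 ?ler0n // ltW.
(* These are the coefficients of [eps] and [E] in [l1_error_le] for [b = 2 eps] and [d = mumax],
   multiplied by [B], which bounds the l1 operator norms of both pseudoinverses. *)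
exists (B * (4 * (K / eta) * c)), (B * (4 * (K / eta) * mumax + 2)); split.
- by rewrite mulr_ge0 // mulr_ge0 // mulr_ge0.
- by rewrite mulr_ge0 // addr_ge0 // mulr_ge0 // mulr_ge0.
move=> eps eps0 x1 x2 e e_eps y xs1 xs2 [feas opt].
pose h1 := Psi1 *m (xs1 - x1); pose h2 := Psi2 *m (xs2 - x2).
have res : y - A1 *m x1 - A2 *m x2 = e.
  by rewrite /y -addrA -opprD addrC addKr.
(* [D1 h1 + D2 h2] is the difference of the residuals of the true signal and of the minimizer, each
   of norm at most [eps]. *)
have vb k : normc ((D1 *m h1 + D2 *m h2) k 0) <= 2 * eps.
  have -> : D1 *m h1 + D2 *m h2 = e - (y - A1 *m xs1 - A2 *m xs2).
    rewrite /D1 /D2 /h1 /h2 !mulmxA -(mulmxA A1) -(mulmxA A2).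
    rewrite !mpinv_mulVmx // !mulmx1 !mulmxBr -res.
    by apply/matrixP => i j; rewrite !mxE; ring.
  rewrite mxE; apply: le_trans (normcD_le _ _) _.
  rewrite [X in _ + normc X]mxE normcN.
  have := le_trans (normc_le_norm2 e k) e_eps.
  have := le_trans (normc_le_norm2 (y - A1 *m xs1 - A2 *m xs2) k) feas.
  lra.
(* The true signal is feasible, its residual being [e], and [Psi x + h] is [Psi] applied to the
   minimizer. *)
have l1opt : norm1 (Psi1 *m x1 + h1) + norm1 (Psi2 *m x2 + h2) <=
    norm1 (Psi1 *m x1) + norm1 (Psi2 *m x2).
  rewrite /h1 /h2 -!mulmxDr ![_ + (_ - _)]addrC !subrK.
  by apply: opt; rewrite /feasible res.
have eps20 : 0 <= 2 * eps by rewrite mulr_ge0.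
have l1 := l1_error_le D10 D20 (le_trans mu12 mu2a) mu2a mummax amax eta0
  eps20 vb l1opt.
apply: le_trans (norm2_le_norm1 _) _.
rewrite opp_col_mx add_col_mx norm1_col_mx.
have -> : xs1 - x1 = mpinv Psi1 *m h1 by rewrite mulmxA mpinv_mulVmx // mul1mx.
have -> : xs2 - x2 = mpinv Psi2 *m h2 by rewrite mulmxA mpinv_mulVmx // mul1mx.
apply: (@le_trans _ _ (B * (norm1 h1 + norm1 h2))).
  have := norm1_mulmx_le (mpinv Psi1) h1; have := norm1_mulmx_le (mpinv Psi2) h2.
  have := mulr_ge0 (sum_ge0 _ _ (mpinv Psi1)) (norm1_ge0 h2).
  have := mulr_ge0 (sum_ge0 _ _ (mpinv Psi2)) (norm1_ge0 h1).
  by rewrite /B; lra.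
apply: le_trans (ler_wpM2l B0 l1) _.
rewrite -/c -/K -/eta le_eqVlt; apply/orP; left; apply/eqP; ring.
Qed.
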